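(* Fix an integer $q\ge2$, a finite family $U_j\subseteq\Delta_q(r_j)$ $(1\le j\le s)$, a cap $C\ge0$, a starting degree $d_0$, a modulus $L$, a residue class $\ell\pmod L$, a polynomial $P_\ell\in\mathbb Q[d]$ of degree at most $q-1$, and a constant $\delta\in\mathbb Q$. One seeks nonnegative rational weights $z_{j,t}$ (indexed by $1\le j\le s$ and capped states $t\in\{0,\dots,C\}^q$) and one constant $\delta'\le\delta$ such that, for every $d\ge d_0$ with $d\equiv\ell\pmod L$, \[ F_d(x)\ge1\quad(x\in\Delta_q(d)),\qquad \operatorname{cost}(F_d)=P_\ell(d)+\delta'. \] For the data fixed above, these requirements are equivalent to the feasibility of a finite rational linear system.
   Context: For integers $q\ge 2$, $d\ge 0$, let $\Delta_q(d)=\{a\in\mathbb Z_{\ge0}^q:\sum_{i=1}^q a_i=d\}$ (empty for $d<0$), and let $e_1,\dots,e_q$ be the standard unit vectors of $\mathbb Z^q$. The graph $G_q(d)$ has vertex set $\Delta_q(d)$; distinct $a,b$ are adjacent exactly when $a-b=e_i-e_j$ for some $i\ne j$. $G_q(r)[U]$ is the induced subgraph on $U\subseteq\Delta_q(r)$, and $\alpha$ is the independence number. For $a\in\mathbb Z_{\ge0}^q$ put $\tau_C(a)=(\min(a_1,C),\dots,\min(a_q,C))$. For each $d$, each $j$ and each anchor $a\in\Delta_q(d-r_j)$, the translate $a+U_j=\{a+u:u\in U_j\}\subseteq\Delta_q(d)$ is given weight $z_{j,\tau_C(a)}$. The coverage of $x\in\Delta_q(d)$ is the total weight of the translates containing $x$,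 \[ F_d(x)=\sum_{j=1}^s\ \sum_{\substack{a\in\Delta_q(d-r_j)\\ x\in a+U_j}}z_{j,\tau_C(a)}, \] and the cost is \[ \operatorname{cost}(F_d)=\sum_{j=1}^s\ \sum_{a\in\Delta_q(d-r_j)}z_{j,\tau_C(a)}\,\alpha(G_q(r_j)[U_j]). \] A finite rational linear system means a finite system of linear equations and inequalities with rational coefficients in finitely many variables. *)

(* Defs.v *)
From HB Require Import structures.
From mathcomp Require Import all_boot all_order all_algebra.

Set Implicit Arguments.
Unset Strict Implicit.
Unset Printing Implicit Defensive.

Import Order.TTheory GRing.Theory Num.Theory.

(* Points of Z_{>=0}^q of coordinate sum d.  Every coordinate is at most d,
   so storing coordinates in 'I_d.+1 loses nothing and makes this a finType. *)
Record simplex (q d : nat) := Simplex {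
  simplex_val :> {ffun 'I_q -> 'I_d.+1};
  _ : (\sum_(i < q) simplex_val i == d)%N }.

HB.instance Definition _ q d := [isSub for @simplex_val q d].
HB.instance Definition _ q d := [Countable of simplex q d by <:].
HB.instance Definition _ q d := [Finite of simplex q d by <:].

Section Graph.
Local Open Scope ring_scope.

Definition zvec (q d : nat) (a : simplex q d) : 'rV[int]_q :=
  \row_(i < q) (a i : nat)%:Z.

Definition unit_vec (q : nat) (i : 'I_q) : 'rV[int]_q := delta_mx 0 i.

Definition G (q d : nat) : rel (simplex q d) := fun a b =>
  (a != b) &&
  [exists i, exists j,
     (i != j) && (zvec a - zvec b == unit_vec i - unit_vec j)].

End Graph.

Definition induced (V : finType) (e : rel V) (U : {set V}) :
  rel {x : V | x \in U} := fun x y => e (val x) (val y).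
Arguments induced {V} e U _ _.

Definition independent (V : finType) (e : rel V) (S : {set V}) : bool :=
  [forall x in S, forall y in S, ~~ e x y].

Definition alpha (V : finType) (e : rel V) : nat :=
  \max_(S : {set V} | independent e S) #|S|.

Definition state (q C : nat) := {ffun 'I_q -> 'I_C.+1}.

Definition tau (q C d : nat) (a : simplex q d) : state q C :=
  [ffun i => inord (minn (a i) C)].

Definition in_translate (q d e r : nat)
    (x : simplex q d) (a : simplex q e) (U : {set simplex q r}) : bool :=
  [exists u in U, [forall i, (x i == a i + u i :> nat)%N]].

Section Weights.
Local Open Scope ring_scope.

Variables (q s : nat) (r : 'I_s -> nat).
Variable U : forall j : 'I_s, {set simplex q (r j)}.
Variable C : nat.

Definition weights := 'I_s -> state q C -> rat.

(* The guard r j <= d excludes the degrees with d - r j negative, for which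
   there are no anchors; subtraction on nat is truncated. *)
Definition coverage (z : weights) (d : nat) (x : simplex q d) : rat :=
  \sum_(j < s | (r j <= d)%N)
    \sum_(a : simplex q (d - r j) | in_translate x a (U j)) z j (tau C a).

Definition cost (z : weights) (d : nat) : rat :=
  \sum_(j < s | (r j <= d)%N)
    \sum_(a : simplex q (d - r j))
      z j (tau C a) * (alpha (induced (@G q (r j)) (U j)))%:R.

Definition requirements (d0 L l : nat) (P : {poly rat}) (delta : rat)
    (z : weights) (delta' : rat) : Prop :=
  [/\ forall j t, 0 <= z j t,
      delta' <= delta
    & forall d : nat, (d0 <= d)%N -> d = l %[mod L] ->
        (forall x : simplex q d, 1 <= coverage z x) /\
        cost z d = P.[d%:R] + delta'].

End Weights.

Section LinearSystem.
Local Open Scope ring_scope.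

Variant relation := Eq | Le | Ge.

Record constraint (V : finType) := Constraint {
  coef : V -> rat;
  rel_of : relation;
  rhs : rat }.

Definition satisfies (V : finType) (v : V -> rat) (c : constraint V) : Prop :=
  let lhs := \sum_i coef c i * v i in
  match rel_of c with
  | Eq => lhs = rhs c
  | Le => lhs <= rhs c
  | Ge => rhs c <= lhs
  end.

Definition linear_system (V : finType) := seq (constraint V).

Definition solution (V : finType) (S : linear_system V) (v : V -> rat) : Prop :=
  foldr (fun c Q => satisfies v c /\ Q) True S.

Definition feasible (V : finType) (S : linear_system V) : Prop :=
  exists v : V -> rat, solution S v.

End LinearSystem.

(* One unknown per weight z_{j,t}; None is the unknown delta'. *)
Definition unknown (s q C : nat) : finType :=
  option ('I_s * state q C)%type.

Definition assignment (s q C : nat) (z : weights q s C) (delta' : rat) :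
  unknown s q C -> rat :=
  fun v => if v is Some (j, t) then z j t else delta'.

(* Main.v *)
Require Import Defs.
From HB Require Import structures.
From mathcomp Require Import all_boot all_order all_algebra.
From mathcomp Require boolp.

(** The requirements are a conjunction of infinitely many linear constraints on
the unknowns, so it suffices to replace each infinite family by a finite one.
The cost equations span a finite-dimensional space, so finitely many of them
imply all the others.
In a coverage inequality the coefficient of [z_{j,t}] counts anchors [a] with
[x] in [a + U_j]; since [a] is recovered from [x] and [x - a], this count is
bounded independently of [d] and [x], so only finitely many distinct
inequalities occur. *)

Set Implicit Arguments.
Unset Strict Implicit.
Unset Printing Implicit Defensive.

Import Order.TTheory GRing.Theory Num.Theory.
Local Open Scope ring_scope.

(** * Sets of assignments cut out by finite rational linear systems *)

Section Definability.

Variable V : finType.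
Implicit Types (v : V -> rat) (c : constraint V) (A B : (V -> rat) -> Prop).

Definition linearly_definable A : Prop :=
  exists S : linear_system V, forall v, solution S v <-> A v.

Lemma solution_cat (S T : linear_system V) v :
  solution (S ++ T) v <-> solution S v /\ solution T v.
Proof.
elim: S => [|c S IH] /=; first by split=> [|[]].
by split=> [[? /IH[]]|[[? ?] ?]]; split=> //; apply/IH.
Qed.

Lemma definable_ext A B :
  (forall v, A v <-> B v) -> linearly_definable A -> linearly_definable B.
Proof. by move=> AB [S SA]; exists S => v; rewrite SA. Qed.

Lemma definable_and A B :
  linearly_definable A -> linearly_definable B ->
  linearly_definable (fun v => A v /\ B v).
Proof.
by move=> [S SA] [T TB]; exists (S ++ T) => v; rewrite solution_cat SA TB.
Qed.

Lemma definable_satisfies c : linearly_definable (fun v => satisfies v c).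
Proof. by exists [:: c] => v; split=> [[]|]. Qed.

Lemma definable_all_seq (T : eqType) (s : seq T) (A : T -> (V -> rat) -> Prop) :
  (forall t, linearly_definable (A t)) ->
  linearly_definable (fun v => forall t, t \in s -> A t v).
Proof.
move=> defA; elim: s => [|t s IH]; first by exists [::] => v; split.
apply: definable_ext (definable_and (defA t) IH) => v.
split=> [[At As] u|As]; first by rewrite inE => /predU1P[->|/As].
by split=> [|u us]; apply: As; rewrite inE ?eqxx ?us ?orbT.
Qed.

(** [D] need not be decidable: classical [asbool] filters the enumeration of [T], so the system is
    shown to exist without being computed. *)
Lemma definable_all_fin (T : finType) (D : T -> Prop)
    (A : T -> (V -> rat) -> Prop) :
  (forall t, linearly_definable (A t)) ->
  linearly_definable (fun v => forall t, D t -> A t v).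
Proof.
move=> /(definable_all_seq [seq t <- enum T | boolp.asbool (D t)]).
apply: definable_ext => v; split=> DA t.
  by move=> /boolp.asboolP Dt; apply: DA; rewrite mem_filter Dt mem_enum.
by rewrite mem_filter => /andP[/boolp.asboolP Dt _]; apply: DA.
Qed.

(** Natural coefficients at most [N] form a vector in the finite type [{ffun V -> 'I_N.+1}], and [b]
    is common to all the inequalities, so only finitely many of them are distinct. *)
Lemma definable_bounded_ineqs (I : Type) (D : I -> Prop) (N : nat)
    (c : I -> V -> nat) (b : rat) :
  (forall i k, D i -> (c i k <= N)%N) ->
  linearly_definable
    (fun v => forall i, D i -> b <= \sum_k (c i k)%:R * v k).
Proof.
move=> cN.
pose attained (f : {ffun V -> 'I_N.+1}) :=
  exists2 i, D i & forall k, c i k = f k.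
have := definable_all_fin attained (fun f : {ffun V -> 'I_N.+1} =>
  definable_satisfies (Constraint (fun k => (f k : nat)%:R) Ge b)).
apply: definable_ext => v; split=> [sat i Di|sat f [i Di cE]].
  have cE k : c i k = [ffun k => inord (c i k) : 'I_N.+1] k.
    by rewrite ffunE inordK // ltnS cN.
  by under eq_bigr => k _ do rewrite cE; apply: sat; exists i.
rewrite /satisfies /=; under eq_bigr => k _ do rewrite -cE.
exact: sat.
Qed.

End Definability.

(** * Infinite families of linear equations *)

Lemma finite_spanning_subfamily (K : fieldType) (W : vectType K)
    (A : W -> Prop) :
  exists2 X : seq W,
    forall w, w \in X -> A w & forall w, A w -> w \in <<X>>%VS.
Proof.
(* Here [n] bounds the codimension of the span of [X]; each vector of [A] adjoined from outside the
   span lowers it. *)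
suff ext n (X : seq W) : (forall w, w \in X -> A w) ->
    (\dim {:W} <= n + \dim <<X>>)%N ->
    exists2 Y : seq W, forall w, w \in Y -> A w & forall w, A w -> w \in <<Y>>%VS.
  by apply: (ext (\dim {:W}) [::]) => //; rewrite leq_addr.
elim: n X => [|n IH] X XA dimX.
  exists X => // w _; suff /eqP-> : (<<X>> == fullv)%VS by apply: memvf.
  by rewrite eqEdim subvf.
have [AX|] := boolp.EM (forall w, A w -> w \in <<X>>%VS); first by exists X.
move=> /boolp.existsNP[w /boolp.not_implyP[Aw /negP wX]].
apply: (IH (w :: X)) => [u|]; first by rewrite inE => /predU1P[->|/XA].
apply: leq_trans dimX _; rewrite addSnnS leq_add2l ltnNge.
(* If adjoining [w] did not raise the dimension, the two nested spans would coincide and [w] would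
   already lie in the first. *)
apply: contra wX => le_dim.
have /eqP-> : (<<X>> == <<w :: X>>)%VS.
  by rewrite eqEdim le_dim andbT span_cons addvSr.
by rewrite memv_span ?mem_head.
Qed.

Lemma definable_equations (V : finType) (I : Type) (D : I -> Prop)
    (c : I -> V -> rat) (b : I -> rat) :
  linearly_definable
    (fun v => forall i, D i -> \sum_k c i k * v k = b i).
Proof.
(* An equation is encoded as its coefficients with its right-hand side at [None]. *)
pose W := {ffun option V -> rat^o}.
pose holds (w : W) (v : V -> rat) := \sum_k w (Some k) * v k = w None.
pose eqn i : W := [ffun o => if o is Some k then c i k else b i].
have eqnE i v : holds (eqn i) v <-> \sum_k c i k * v k = b i.
  by rewrite /holds ffunE; under eq_bigr => k _ do rewrite ffunE.
have [X XD DX] := finite_spanning_subfamily (fun w => exists2 i, D i & w = eqn i).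
(* For fixed [v], [holds] is a homogeneous linear condition on [w], hence inherited by linear
   combinations. *)
have holds_span v w : (forall u, u \in X -> holds u v) -> w \in <<X>>%VS ->
    holds w v.
  move=> Xv /(coord_span (X := in_tuple X)) ->.
  rewrite /holds sum_ffunE.
  under eq_bigr => k _ do rewrite sum_ffunE mulr_suml.
  rewrite exchange_big; apply: eq_bigr => i _ /=.
  rewrite ffunE -(Xv X`_i) ?mem_nth // scaler_sumr.
  by apply: eq_bigr => k _; rewrite ffunE -mulrA.
have := definable_all_seq X (fun w : W => definable_satisfies
  (Constraint (fun k => w (Some k)) Eq (w None))).
apply: definable_ext => v; split=> [Xv i Di|sat w /XD[i Di ->]].
  by apply/eqnE/holds_span/DX; [exact: Xv | exists i].
exact/eqnE/sat.
Qed.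

(** * Coverage and cost as linear forms in the unknowns *)

Lemma card_anchors q d e r (x : simplex q d) (U : {set simplex q r}) :
  (#|[pred a : simplex q e | in_translate x a U]| <= #|U|)%N.
Proof.
pose diff (a : simplex q e) (u : simplex q r) :=
  [forall i, (x i == a i + u i :> nat)%N].
(* On the anchors of translates containing [x], [f] returns the difference [x - a]; it is injective
   there because [x] and the difference determine [a]. *)
pose f a := [pick u in U | diff a u].
have fP a : in_translate x a U -> exists2 u, u \in U & f a = Some u /\ diff a u.
  move=> /existsP[u]; rewrite /f; case: pickP => [v /andP[vU av] _|/(_ u)->//].
  by exists v.
rewrite -(card_imset U (@Some_inj _)) -(card_in_imset (f := f)).
  apply/subset_leq_card/subsetP => _ /imsetP[a /fP[u uU [-> _]] ->].
  exact: imset_f.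
move=> a a' /fP[u _ [-> /forallP au]] /fP[v _ [-> /forallP av]] [uv].
apply/val_inj/ffunP => i; apply/val_inj/eqP.
by rewrite -(eqn_add2r (u i)) -(eqP (au i)) uv (eqP (av i)).
Qed.

Section Requirements.

Variables (q s : nat) (r : 'I_s -> nat).
Variable U : forall j : 'I_s, {set simplex q (r j)}.
Variable C : nat.

(** Grouping anchors by capped state turns a sum whose range grows with [d] into a linear form in a
    fixed set of unknowns. *)
Lemma sum_by_tau d (A : pred (simplex q d)) (f : state q C -> rat) :
  \sum_(a | A a) f (tau C a) =
  \sum_t #|[pred a | A a && (tau C a == t)]|%:R * f t.
Proof.
rewrite (partition_big (@tau q C d) predT) //=; apply: eq_bigr => t _.
rewrite (eq_bigr (fun=> f t)) => [|a /andP[_ /eqP->]//].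
by rewrite sumr_const mulr_natl.
Qed.

Lemma sum_unknown (F : unknown s q C -> rat) :
  \sum_o F o = F None + \sum_j \sum_t F (Some (j, t)).
Proof.
rewrite (bigD1 None) //=; congr (_ + _).
rewrite pair_bigA (reindex_omap Some id) => [|[]] //=.
by apply: eq_big => [p|[j t] _]; rewrite ?eqxx.
Qed.

(** The values are kept in [nat] so that a uniform bound leaves finitely many coefficient
    vectors. *)
Definition coverage_coef d (x : simplex q d) (o : unknown s q C) : nat :=
  if o is Some (j, t) then
    if (r j <= d)%N then
      #|[pred a : simplex q (d - r j) |
          in_translate x a (U j) && (tau C a == t)]|
    else 0
  else 0.

Lemma coverageE (z : weights q s C) (delta' : rat) d (x : simplex q d) :
  coverage U z x = \sum_o (coverage_coef x o)%:R * assignment z delta' o.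
Proof.
rewrite sum_unknown mul0r add0r /coverage big_mkcond.
apply: eq_bigr => j _ /=; case: ifP => _; first exact: sum_by_tau.
by rewrite big1 // => t _; rewrite mul0r.
Qed.

Lemma coverage_coef_le d (x : simplex q d) o :
  (coverage_coef x o <= \max_j #|U j|)%N.
Proof.
case: o => [[j t]|] //=; case: ifP => // _.
apply: leq_trans (leq_bigmax j); apply: leq_trans (card_anchors _ x (U j)).
by apply/subset_leq_card/subsetP => a /andP[].
Qed.

(** The entry [-1] moves the unknown [delta'] to the left-hand side, leaving the known value of [P]
    at [d] on the right. *)
Definition cost_coef d (o : unknown s q C) : rat :=
  if o is Some (j, t) then
    if (r j <= d)%N then
      (#|[pred a : simplex q (d - r j) | tau C a == t]| *
       alpha (induced (@G q (r j)) (U j)))%:R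
    else 0
  else -1.

Lemma cost_coefE (z : weights q s C) (delta' : rat) d :
  \sum_o cost_coef d o * assignment z delta' o = cost U z d - delta'.
Proof.
rewrite sum_unknown mulN1r addrC /cost [in RHS]big_mkcond; congr (_ - _).
apply: eq_bigr => j _ /=; case: ifP => _; last first.
  by rewrite big1 // => t _; rewrite mul0r.
rewrite -mulr_suml sum_by_tau mulr_suml; apply: eq_bigr => t _.
by rewrite natrM mulrAC.
Qed.

Lemma definable_requirements d0 L l (P : {poly rat}) delta :
  linearly_definable (fun v : unknown s q C -> rat =>
    requirements U d0 L l P delta (fun j t => v (Some (j, t))) (v None)).
Proof.
pose D d := (d0 <= d)%N /\ d = l %[mod L].
pose weight_of (v : unknown s q C -> rat) : weights q s C :=
  fun j t => v (Some (j, t)).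
have vE v : assignment (weight_of v) (v None) =1 v by case=> [[]|].
(* An indicator coefficient vector expresses a bound on a single unknown, as needed for the signs of
   the weights and for [delta]. *)
have sum_single (o : unknown s q C) (v : unknown s q C -> rat) :
    \sum_k (k == o)%:R * v k = v o.
  rewrite (bigD1 o) //= eqxx mul1r big1 ?addr0 // => k /negPf->.
  by rewrite mul0r.
have nonneg : linearly_definable (fun v : unknown s q C -> rat =>
    forall p : 'I_s * state q C, True -> 0 <= v (Some p)).
  apply: definable_all_fin => p.
  apply: definable_ext (definable_satisfies
    (Constraint (fun k => (k == Some p)%:R) Ge 0)) => v.
  by rewrite /satisfies /= sum_single.
have le_delta : linearly_definable (fun v : unknown s q C -> rat =>
    v None <= delta).
  apply: definable_ext (definable_satisfies
    (Constraint (fun k => (k == None)%:R) Le delta)) => v.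
  by rewrite /satisfies /= sum_single.
(* Points of all degrees are gathered into one sigma type, so that one bound, the largest [#|U j|],
   serves every degree at once. *)
have covered := @definable_bounded_ineqs (unknown s q C) {d & simplex q d}
  (fun x => D (tag x)) _ (fun x => coverage_coef (tagged x)) 1
  (fun x o _ => coverage_coef_le (tagged x) o).
have costed := @definable_equations (unknown s q C) nat D cost_coef
  (fun d => P.[d%:R]).
have covE v d (x : simplex q d) :
    \sum_o (coverage_coef x o)%:R * v o = coverage U (weight_of v) x.
  by rewrite (coverageE _ (v None)); under [RHS]eq_bigr do rewrite vE.
have costE v d :
    \sum_o cost_coef d o * v o = cost U (weight_of v) d - v None.
  by rewrite -cost_coefE; under [RHS]eq_bigr do rewrite vE.
apply: definable_ext (definable_and (definable_and nonneg le_delta)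
  (definable_and covered costed)) => v.
split=> [[[v0 vd] [cov cst]]|[v0 vd req]].
  split=> // [j t|d dd0 dl]; first exact: v0.
  split=> [x|].
    by rewrite -covE; apply: (cov (existT _ d x)).
  by apply/eqP; rewrite -subr_eq -costE cst.
split; split=> //.
- by move=> [j t] _; exact: v0.
- by move=> [d x] [dd0 dl]; rewrite covE; apply: (req d dd0 dl).1.
- by move=> d [dd0 dl]; rewrite costE (req d dd0 dl).2 addrK.
Qed.

End Requirements.

Theorem theorem3p3
  (q : nat) (q_ge2 : (2 <= q)%N)
  (s : nat) (r : 'I_s -> nat) (U : forall j : 'I_s, {set simplex q (r j)})
  (C d0 L l : nat) (L_gt0 : (0 < L)%N)
  (P : {poly rat}) (degP : (size P <= q)%N) (delta : rat) :
  exists S : linear_system (unknown s q C),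
    (forall (z : weights q s C) (delta' : rat),
       requirements U d0 L l P delta z delta' <->
       solution S (assignment z delta')) /\
    ((exists (z : weights q s C) (delta' : rat),
        requirements U d0 L l P delta z delta') <->
     feasible S).
Proof.
have [S SE] := definable_requirements U C d0 L l P delta.
exists S; split=> [z delta'|].
  by rewrite (SE (assignment z delta')).
split=> [[z [delta' req]]|[v /(SE v) req]].
  by exists (assignment z delta'); apply/(SE (assignment z delta')).
(* An arbitrary solution is decoded into weights at the [Some] entries and the constant [delta'] at
   [None]. *)
by exists (fun j t => v (Some (j, t))), (v None).
Qed.
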